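(* Let $\mathbb{K}$ be a field, $S=\mathbb{K}[x_1,\dots,x_n]$, and let $J\subseteq I$ be two monomial ideals in $S$. Then for every integer $k\geq 1$, $${\rm sdepth}\big(\overline{I^k}/\overline{J^k}\big) \leq {\rm sdepth}\big(\overline{I}/\overline{J}\big).$$
   Context: $S=\mathbb{K}[x_1,\dots,x_n]$ is the polynomial ring over a field $\mathbb{K}$ with its standard $\mathbb{Z}^n$-grading ($\deg x_i=e_i$). Stanley depth: let $M$ be a finitely generated $\mathbb{Z}^n$-graded $S$-module. For a homogeneous element $u\in M$ and a subset $Z\subseteq\{x_1,\dots,x_n\}$, let $u\mathbb{K}[Z]$ be the $\mathbb{K}$-subspace of $M$ generated by all elements $uv$ with $v\in\mathbb{K}[Z]$. It is called a Stanley space of dimension $|Z|$ if it is a free $\mathbb{K}[Z]$-module. A Stanley decomposition $\mathcal{D}$ of $M$ is a decomposition of $M$ (as a $\mathbb{K}$-vector space) as a finite direct sum of Stanley spaces. The Stanley depth ${\rm sdepth}(\mathcal{D})$ is the minimum dimension of a Stanley space in $\mathcal{D}$, and ${\rm sdepth}(M)$ is the maximum of ${\rm sdepth}(\mathcal{D})$ over all Stanley decompositions $\mathcal{D}$ of $M$. Convention: ${\rm sdepth}(0)=\infty$ (empty decomposition). Integral closure: for an ideal $I\subseteq S$, an element $f\in S$ is integral over $I$ if there is an equation $f^m+c_1f^{m-1}+\dots+c_{m-1}f+c_m=0$ with $m\ge 1$ and $c_i\in I^i$. The integral closure $\overline{I}$ is the set of all elements of $S$ integral over $I$. For a monomial ideal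 $I$, it is known that $\overline{I}$ is the monomial ideal generated by all monomials $u\in S$ such that $u^m\in I^m$ for some integer $m\geq 1$. *)

(* Defs.v *)
From HB Require Import structures.
From mathcomp Require Import all_boot all_order all_algebra.
From mathcomp Require Import generic_quotient ring_quotient.
From mathcomp Require Import boolp.
From mathcomp Require Import mpoly.

Set Implicit Arguments.
Unset Strict Implicit.
Unset Printing Implicit Defensive.

Import GRing.Theory.
Local Open Scope ring_scope.
Local Open Scope quotient_scope.

Section SubQuotient.
Variables (R : pzRingType) (V : lmodType R) (A B : submodClosed V).

Definition submod_type := {x : V | x \in A}.

HB.instance Definition _ := [Choice of submod_type by <:].
HB.instance Definition _ := [isSub of submod_type for @sval V (fun x => x \in A)].
HB.instance Definition _ := [SubChoice_isSubLmodule of submod_type by <:].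

Definition in_submod : {pred submod_type} := fun x => val x \in B.

Fact in_submodE x : (x \in in_submod) = (val x \in B).
Proof. by []. Qed.

Fact in_submod_zmod_closed : zmod_closed in_submod.
Proof.
split=> [|x y]; rewrite !in_submodE; first by rewrite raddf0 rpred0.
by rewrite raddfB; apply: (GRing.submod_closedB (submodClosedP B)).2.
Qed.

HB.instance Definition _ :=
  GRing.isZmodClosed.Build submod_type in_submod in_submod_zmod_closed.

(* The inclusion of B in A is not part of the type: [subquot] is A modulo its
   intersection with B, that is A / B when B is contained in A. *)
Definition subquot := Quotient.quot in_submod.

HB.instance Definition _ := GRing.Zmodule.on subquot.

Definition subquot_pi (x : submod_type) : subquot := \pi_(Quotient.quot in_submod) x.

Definition subquot_scale (a : R) (w : subquot) : subquot :=
  subquot_pi (a *: repr (w : Quotient.quot in_submod)).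

Fact subquot_piP x y :
  reflect (subquot_pi x = subquot_pi y) (val x - val y \in B).
Proof.
have -> : (val x - val y \in B) = Quotient.equiv in_submod x y.
  by rewrite Quotient.equivE in_submodE raddfB.
rewrite Quotient.equivE Quotient.idealrBE; exact: eqP.
Qed.

Fact subquot_pi_repr (w : subquot) :
  subquot_pi (repr (w : Quotient.quot in_submod)) = w.
Proof. exact: reprK. Qed.

Fact subquot_piD : {morph subquot_pi : x y / x + y}.
Proof. exact: raddfD. Qed.

Fact subquot_piZ a x : subquot_scale a (subquot_pi x) = subquot_pi (a *: x).
Proof.
apply/subquot_piP; rewrite !linearZ -scalerDr; apply: rpredZ.
by apply/subquot_piP; rewrite subquot_pi_repr.
Qed.

Fact subquot_scaleA a b w :
  subquot_scale a (subquot_scale b w) = subquot_scale (a * b) w.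
Proof. by rewrite -[w]subquot_pi_repr !subquot_piZ scalerA. Qed.

Fact subquot_scale1 : left_id 1 subquot_scale.
Proof. by move=> w; rewrite -[w]subquot_pi_repr subquot_piZ scale1r. Qed.

Fact subquot_scaleDr : right_distributive subquot_scale +%R.
Proof.
move=> a w w'; rewrite -[w]subquot_pi_repr -[w']subquot_pi_repr.
by rewrite -subquot_piD !subquot_piZ scalerDr subquot_piD.
Qed.

Fact subquot_scaleDl w : {morph subquot_scale^~ w : a b / a + b}.
Proof.
move=> a b; rewrite -[w]subquot_pi_repr !subquot_piZ.
by rewrite scalerDl subquot_piD.
Qed.

HB.instance Definition _ := GRing.Zmodule_isLmodule.Build R subquot
  subquot_scaleA subquot_scale1 subquot_scaleDr subquot_scaleDl.

End SubQuotient.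

(* Ideals as S-submodules of S (the library's [idealr] excludes the unit ideal).
   Membership is a boolean predicate; using [asbool], every subset is one. *)
Notation ideal S := (submodClosed S^o).

Section Ideals.
Variable (S : comNzRingType).
Implicit Types (I : ideal S) (f g : S).

Definition in_ideal_pow I (k : nat) : {pred S^o} := fun f =>
  `[< exists (r : nat) (a : 'I_r -> S) (g : 'I_r -> 'I_k -> S),
        (forall i j, g i j \in I) /\ f = \sum_(i < r) a i * \prod_(j < k) g i j >].

Fact in_ideal_pow_submod_closed I k : submod_closed (in_ideal_pow I k).
Proof.
split=> [|b f f' /asboolP[r [a [g [gI ->]]]] /asboolP[r' [a' [g' [g'I ->]]]]].
  apply/asboolP; exists 0%N, (fun=> 0), (fun _ _ => 0).
  by split=> [[]//|]; rewrite big_ord0.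
apply/asboolP; exists (r + r')%N.
exists (fun i => match split i with inl i => b * a i | inr i => a' i end).
exists (fun i => match split i with inl i => g i | inr i => g' i end).
split=> [i j|]; first by case: (split i) => i'; [apply: gI | apply: g'I].
rewrite big_split_ord /= /GRing.scale /= mulr_sumr; congr (_ + _).
  apply: eq_bigr => i _; case: splitP => [i' /= /ord_inj <-|i' /= e].
    by rewrite mulrA.
  by have := ltn_ord i; rewrite e ltnNge leq_addr.
apply: eq_bigr => i _; case: splitP => [i' /= e|i' /= /addnI /ord_inj <- //].
by have := ltn_ord i'; rewrite -e ltnNge leq_addr.
Qed.

HB.instance Definition _ I k := GRing.isSubmodClosed.Build S S^o
  (in_ideal_pow I k) (GRing.submod_closed_semi (in_ideal_pow_submod_closed I k)).

Definition ideal_pow I k : ideal S := in_ideal_pow I k.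

Definition integral_over_ideal I f : Prop :=
  exists (m : nat) (c : nat -> S),
    [/\ (0 < m)%N, (forall i, (1 <= i <= m)%N -> c i \in ideal_pow I i)
      & f ^+ m + \sum_(1 <= i < m.+1) c i * f ^+ (m - i) = 0].

Definition in_integral_closure I : {pred S^o} :=
  fun f => `[< integral_over_ideal I f >].

(* [in_integral_closure I] is an ideal: f is integral over I exactly when f t is
   integral over the Rees algebra [\bigoplus_i I^i t^i] inside S[t]. *)

Fact ideal_pow0 I f : f \in ideal_pow I 0.
Proof.
apply/asboolP; exists 1%N, (fun=> f), (fun _ _ => 0); split=> [i []//|].
by rewrite big_ord1 big_ord0 mulr1.
Qed.

Fact ideal_powM I k l f g :
  f \in ideal_pow I k -> g \in ideal_pow I l -> f * g \in ideal_pow I (k + l).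
Proof.
have mulI m (a b : S) : b \in ideal_pow I m -> a * b \in ideal_pow I m.
  by move=> bI; apply: (@rpredZ S S^o (ideal_pow I m) a b bI).
move=> /asboolP[r [a [u [uI ->]]]] /asboolP[r' [b [v [vI ->]]]].
rewrite mulr_suml; apply: rpred_sum => i _.
rewrite mulr_sumr; apply: rpred_sum => i' _.
rewrite mulrACA; apply: mulI; apply/asboolP; exists 1%N, (fun=> 1).
exists (fun _ j => match split j with inl j => u i j | inr j => v i' j end).
split=> [_ j|]; first by case: (split j) => j'; [apply: uI | apply: vI].
rewrite big_ord1 mul1r big_split_ord /=; congr (_ * _).
  apply: eq_bigr => j _; case: splitP => [j' /= /ord_inj <- //|j' /= e].
  by have := ltn_ord j; rewrite e ltnNge leq_addr.
apply: eq_bigr => j _; case: splitP => [j' /= e|j' /= /addnI /ord_inj <- //].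
by have := ltn_ord j'; rewrite -e ltnNge leq_addr.
Qed.

Definition in_rees I : {pred {poly S}} :=
  fun p => `[< forall i, p`_i \in ideal_pow I i >].

Fact in_rees_subring_closed I : subring_closed (in_rees I).
Proof.
split=> [|p q /asboolP pI /asboolP qI|p q /asboolP pI /asboolP qI]; apply/asboolP.
- by case=> [|i]; rewrite coef1 ?ideal_pow0 //= rpred0.
- by move=> i; rewrite coefB; exact: ((GRing.submod_closedB (submodClosedP (ideal_pow I i))).2 _ _ (pI i) (qI i)).
- move=> i; rewrite coefM; apply: rpred_sum => j _.
  by have := ideal_powM (pI j) (qI (i - j)%N); rewrite subnKC ?leq_ord.
Qed.

HB.instance Definition _ I :=
  GRing.isSubringClosed.Build {poly S} (in_rees I) (in_rees_subring_closed I).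

Definition rees I := {p : {poly S} | p \in in_rees I}.

HB.instance Definition _ I := [Choice of rees I by <:].
HB.instance Definition _ I :=
  [isSub of rees I for @sval {poly S} (fun p => p \in in_rees I)].
HB.instance Definition _ I := [SubChoice_isSubComNzRing of rees I by <:].

Fact integral_overP I f :
  integral_over_ideal I f <->
  integralOver (val : rees I -> {poly S}) (f%:P * 'X).
Proof.
have [h hE] : exists h : {rmorphism rees I -> {poly S}},
  (h : rees I -> {poly S}) = val by eexists.
rewrite -hE.
split=> [[m [c [m_gt0 cI fc]]]|[P monP /rootP]].
  have mem_c i : (if (0 < i <= m)%N then (c i)%:P * 'X^i else 0) \in in_rees I.
    apply/asboolP => j; case: ifP => [lim|_]; last by rewrite coef0 rpred0.
    by rewrite coefCM coefXn; case: eqP => [->|_];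
      rewrite ?mulr1 ?mulr0 ?rpred0 //; apply: cI.
  pose C i : rees I := @exist _ (fun p => p \in in_rees I) _ (mem_c i).
  pose q := \sum_(1 <= i < m.+1) C i *: 'X^(m - i).
  have sz_q : (size q < size ('X^m : {poly rees I}))%N.
    rewrite size_polyXn ltnS; apply: (leq_trans (size_sum _ _ _)).
    apply/bigmax_leqP_seq => i; rewrite mem_index_iota => /andP[i_gt0 _] _.
    apply: (leq_trans (size_scale_leq _ _)).
    by rewrite size_polyXn ltn_subrL i_gt0.
  exists ('X^m + q).
    by rewrite monicE lead_coefDl // lead_coefXn.
  apply/rootP; rewrite rmorphD rmorph_sum /= map_polyXn hornerD horner_sum hornerXn.
  transitivity ((f ^+ m + \sum_(1 <= i < m.+1) c i * f ^+ (m - i))%:P * 'X^m).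
    rewrite polyCD rmorph_sum mulrDl mulr_suml exprMn rmorphXn; congr (_ + _).
    apply: eq_big_nat => i; rewrite ltnS => lim.
    rewrite map_polyZ map_polyXn hornerZ hornerXn hE [val _]/= lim.
    case/andP: lim => _ lim.
    have -> : 'X^m = 'X^i * 'X^(m - i) :> {poly S} by rewrite -exprD subnKC.
    by rewrite exprMn rmorphM rmorphXn mulrACA.
  by rewrite fc polyC0 mul0r.
pose m := (size P).-1.
have sz_P : size P = m.+1 by rewrite prednK // size_poly_gt0 monic_neq0.
have Pm : P`_m = 1 by apply/eqP; rewrite -monicE.
move=> Pf; exists m, (fun i => (h P`_(m - i))`_i); split.
- rewrite lt0n; apply/eqP => m0; move: Pf.
  have -> : P = 1.
    by rewrite m0 in sz_P Pm; rewrite [P]size1_polyC ?sz_P // Pm.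
  by rewrite rmorph1 hornerC => /eqP; rewrite oner_eq0.
- move=> i _; by rewrite hE; have /asboolP := valP P`_(m - i); apply.
- have E j : ((map_poly h P)`_j * (f%:P * 'X) ^+ j)`_m =
      if (m < j)%N then 0 else (h P`_j)`_(m - j) * f ^+ j.
    by rewrite coef_map exprMn -rmorphXn mulrA coefMXn coefMC.
  have := congr1 (fun p : {poly S} => p`_m) Pf.
  rewrite (@horner_coef_wide _ (size P) (map_poly h P) _ (size_poly _ _)) sz_P coef0 coef_sum.
  apply: etrans; under [RHS]eq_bigr => j _ do rewrite E ltnNge leq_ord.
  rewrite big_ord_recr /= Pm rmorph1 subnn coef1 mul1r addrC; congr (_ + _).
  rewrite big_add1 big_mkord (reindex_inj rev_ord_inj) /=.
  by apply: eq_bigr => j _; rewrite subnSK //= subKn // ltnW.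
Qed.

Fact in_integral_closure_submod_closed I : submod_closed (in_integral_closure I).
Proof.
have [h hE] : exists h : {rmorphism rees I -> {poly S}},
  (h : rees I -> {poly S}) = val by eexists.
split=> [|b f g /asboolP/integral_overP + /asboolP/integral_overP].
  by apply/asboolP/integral_overP; rewrite -hE polyC0 mul0r; apply: integral0.
rewrite -hE => fI gI; apply/asboolP/integral_overP; rewrite -hE.
have mem_b : b%:P \in in_rees I.
  by apply/asboolP => i; rewrite coefC; case: eqP => [->|_];
    rewrite ?ideal_pow0 ?rpred0.
have bI : integralOver h b%:P.
  have := integral_id h (@exist _ (fun p => p \in in_rees I) _ mem_b).
  by rewrite {2}hE.
by rewrite polyCD mulrDl polyCM -mulrA; apply: integral_add => //; apply: integral_mul.
Qed.

HB.instance Definition _ I := GRing.isSubmodClosed.Build S S^o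
  (in_integral_closure I)
  (GRing.submod_closed_semi (in_integral_closure_submod_closed I)).

Definition integral_closure I : ideal S := in_integral_closure I.

End Ideals.

Section Monomial.
Variables (K : fieldType) (n : nat).
Local Notation S := {mpoly K[n]}.

Definition monomial_ideal (I : ideal S) : Prop :=
  exists A : 'X_{1..n} -> Prop, forall f : S,
    f \in I <->
    exists (r : nat) (a : 'I_r -> S) (m : 'I_r -> 'X_{1..n}),
      (forall i, A (m i)) /\ f = \sum_(i < r) a i * 'X_[m i].

Definition poly_degree (d : 'I_n -> int) (f : S) : Prop :=
  forall m, m \in msupp f -> forall i, (m i)%:Z = d i.

(* Degree d part of A / B: the classes of the elements of A of degree d. This is
   a grading when A and B are homogeneous, e.g. monomial. *)
Definition subquot_degree (A B : ideal S) (d : 'I_n -> int) (w : subquot A B) : Prop :=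
  exists x : submod_type A, poly_degree d (val x) /\ w = subquot_pi B x.

End Monomial.

(* Extended natural numbers, with [None] for infinity. *)
Definition enat_le (a b : option nat) : bool :=
  match a, b with
  | _, None => true
  | None, Some _ => false
  | Some a, Some b => (a <= b)%N
  end.

Section Stanley.
Variables (K : fieldType) (n : nat).
Local Notation S := {mpoly K[n]}.
Variables (M : lmodType S) (Mdeg : ('I_n -> int) -> M -> Prop).

Definition homogeneous (u : M) : Prop := exists d, Mdeg d u.

(* f lies in K[Z]; a set of variables is encoded by its set of indices. *)
Definition in_vars (Z : {set 'I_n}) (f : S) : Prop :=
  forall m, m \in msupp f -> forall i, i \notin Z -> m i = 0%N.

(* u K[Z]; the products v u with v in K[Z] already form a K-subspace. *)
Definition cyclic_span (u : M) (Z : {set 'I_n}) (w : M) : Prop :=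
  exists v, in_vars Z v /\ w = v *: u.

(* The K[Z]-submodule W of M has a (not necessarily finite) basis B. *)
Definition free_over (Z : {set 'I_n}) (W : M -> Prop) : Prop :=
  exists B : M -> Prop,
    [/\ forall b, B b -> W b,
        forall w, W w -> exists (r : nat) (p : 'I_r -> S) (b : 'I_r -> M),
          [/\ forall i, in_vars Z (p i), forall i, B (b i)
            & w = \sum_(i < r) p i *: b i]
      & forall (r : nat) (p : 'I_r -> S) (b : 'I_r -> M),
          (forall i, in_vars Z (p i)) -> (forall i, B (b i)) -> injective b ->
          \sum_(i < r) p i *: b i = 0 -> forall i, p i = 0].

Definition stanley_space (u : M) (Z : {set 'I_n}) : Prop :=
  homogeneous u /\ free_over Z (cyclic_span u Z).

(* M is the direct sum of the Stanley spaces [u i] K[[Z i]], i < r. The zero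
   space is free, so it is allowed as a summand; this does not affect [sdepth],
   as removing zero summands cannot decrease the minimal dimension. *)
Definition stanley_decomposition (r : nat) (u : 'I_r -> M) (Z : 'I_r -> {set 'I_n}) :
    Prop :=
  (forall i, stanley_space (u i) (Z i)) /\
  (forall w : M, exists! s : {ffun 'I_r -> M},
     (forall i, cyclic_span (u i) (Z i) (s i)) /\ w = \sum_(i < r) s i).

(* The default value n of the minimum is an upper bound for all dimensions. *)
Definition sdepth_dec (r : nat) (Z : 'I_r -> {set 'I_n}) : option nat :=
  if r == 0%N then None else Some (\big[minn/n]_(i < r) #|Z i|).

Definition attained (d : option nat) : Prop :=
  exists (r : nat) (u : 'I_r -> M) (Z : 'I_r -> {set 'I_n}),
    stanley_decomposition u Z /\ sdepth_dec Z = d.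

(* The maximum of the attained values, all of which lie in {0, ..., n, infinity}.
   Finitely generated Z^n-graded modules have a Stanley decomposition; without
   one, this definition would give 0. *)
Definition sdepth : option nat :=
  if `[< attained None >] then None
  else Some (\max_(d < n.+1 | `[< attained (Some (val d)) >]) val d).

End Stanley.

Definition sdepth_quot (K : fieldType) (n : nat) (A B : ideal {mpoly K[n]}) : option nat :=
  sdepth (@subquot_degree K n A B).

(* Main.v *)
(* Idea: a monomial ideal and its integral closure are spanned by monomials, and
   [x^m] lies in the closure of [I] exactly when [x^(k m)] lies in the closure of
   [I^k]. A Stanley decomposition of a quotient of such ideals is the same thing
   as a partition of the monomials of the quotient into cones, one for each
   nonzero Stanley space [u K[Z]]. The preimage under [m |-> k m] of the cone with
   apex [a] and directions [Z] is empty, or is again a cone with directions [Z],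
   with apex [a / k] rounded up; so a decomposition for the k-th powers pulls back
   to one for [I] and [J] with the same sets [Z].

   That the closure of [I] is spanned by monomials follows from Dickson's lemma
   over any field: if [f] is integral then [f ^ (N + l)] is in [I^l] for some fixed
   [N] and all [l], hence so is the same power of the leading monomial of [f], which
   is therefore integral; subtract the leading term and iterate. *)
Require Import Defs.
From mathcomp Require Import all_boot all_order all_algebra.
From mathcomp Require Import boolp.
From mathcomp Require Import mpoly.
From mathcomp Require Import zify.

Set Implicit Arguments.
Unset Strict Implicit.
Unset Printing Implicit Defensive.

Import GRing.Theory.
Local Open Scope ring_scope.

(** * Monotone subsequences and Dickson's lemma *)

(** Every tail of [u] attains its minimum. Each [phi i] minimises [u] over a tail that contains all
    later choices. *)
Lemma nondecreasing_subseq (u : nat -> nat) :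
  exists phi : nat -> nat, {homo phi : i j / (i < j)%N} /\
    {homo (fun i => u (phi i)) : i j / (i <= j)%N}.
Proof.
have minu N : exists p, (N <= p)%N /\ forall q, (N <= q)%N -> (u p <= u q)%N.
  have exv : exists v, `[< exists2 p, (N <= p)%N & u p = v >].
    by exists (u N); apply/asboolP; exists N.
  case: (ex_minnP exv) => v /asboolP[p Np <-] minv; exists p; split=> // q Nq.
  by apply: minv; apply/asboolP; exists q.
have [g gP] := choice minu.
pose phi := fix F i := if i is j.+1 then g (F j).+1 else g 0%N.
have phi_lt : {homo phi : i j / (i < j)%N}.
  by apply: homo_ltn => [|i]; [exact: ltn_trans | exact: (gP _).1].
exists phi; split=> //; apply: homo_leq => [x|x y z|i]; rewrite ?leqnn //.
  exact: leq_trans.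
case: i => [|i]; apply: (gP _).2 => //.
exact: (phi_lt i i.+2).
Qed.

(** Induction on [s]: a subsequence that works for the tail is refined for [x], and monotonicity
    survives refinement. *)
Lemma dickson (T : eqType) (s : seq T) (u : T -> nat -> nat) :
  exists phi : nat -> nat, {homo phi : i j / (i < j)%N} /\
    {in s, forall x, {homo (fun i => u x (phi i)) : i j / (i <= j)%N}}.
Proof.
elim: s => [|x s [phi [phi_lt phiP]]]; first by exists id; split.
have [psi [psi_lt psiP]] := nondecreasing_subseq (u x \o phi).
exists (phi \o psi); split=> [i j ij|y]; first by apply/phi_lt/psi_lt.
rewrite inE => /predU1P[-> //|ys] i j ij; apply: (phiP y ys).
exact: (ltnW_homo psi_lt).
Qed.

(** * Powers of ideals and ideals spanned by monomials *)

Section MonomialIdeals.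
Variables (K : fieldType) (n : nat).
Local Notation S := {mpoly K[n]}.
Implicit Types (I J A B : ideal S) (f g : S) (m : 'X_{1..n}).

Lemma ideal_mull I f g : g \in I -> f * g \in I.
Proof. by move=> gI; apply: (@rpredZ S S^o I f g gI). Qed.

Lemma idealN I f : f \in I -> - f \in I.
Proof. by move=> fI; rewrite -mulN1r; apply: ideal_mull. Qed.

Lemma idealB I f g : f \in I -> g \in I -> f - g \in I.
Proof. by move=> fI gI; apply: rpredD => //; apply: idealN. Qed.

Lemma ideal_scale I (c : K) f : f \in I -> c *: f \in I.
Proof. by move=> fI; rewrite -mul_mpolyC; apply: ideal_mull. Qed.

Lemma ideal_pow_prod I k (g : 'I_k -> S) :
  (forall j, g j \in I) -> \prod_j g j \in ideal_pow I k.
Proof.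
move=> gI; apply/asboolP; exists 1%N, (fun=> 1), (fun=> g); split=> //.
by rewrite big_ord1 mul1r.
Qed.

Lemma ideal_powS I k l : {subset ideal_pow I (k + l) <= ideal_pow I k}.
Proof.
move=> f /asboolP[r [a [g [gI ->]]]]; apply: rpred_sum => i _.
rewrite big_split_ord /= mulrCA mulrC; apply: ideal_mull.
exact: ideal_pow_prod.
Qed.

Lemma ideal_pow_le I k l : (k <= l)%N -> {subset ideal_pow I l <= ideal_pow I k}.
Proof. by move=> /subnKC <-; apply: ideal_powS. Qed.

Lemma ideal_powX I k l f : f \in ideal_pow I k -> f ^+ l \in ideal_pow I (k * l).
Proof.
move=> fI; elim: l => [|l IHl]; first by rewrite muln0 ideal_pow0.
by rewrite exprS mulnS; apply: ideal_powM.
Qed.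

Lemma ideal_pow1 I f : f \in I -> f \in ideal_pow I 1.
Proof.
by move=> fI; have := @ideal_pow_prod I 1 (fun=> f) (fun=> fI); rewrite big_ord1.
Qed.

Lemma ideal_pow_pow I k l f :
  (f \in ideal_pow (ideal_pow I k) l) = (f \in ideal_pow I (k * l)).
Proof.
apply/idP/idP => /asboolP[r [a [g [gI ->]]]]; apply: rpred_sum => i _; apply: ideal_mull.
  elim: l {a} g gI => [|l IHl] g gI; first by rewrite muln0 ideal_pow0.
  rewrite big_ord_recl mulnS; apply: ideal_powM => //.
  exact: (IHl (fun i j => g i (lift ord0 j))).
elim: l {a} g gI => [|l IHl]; first by move=> g _; rewrite ideal_pow0.
rewrite mulnS => g gI; rewrite big_split_ord -[l.+1]add1n; apply: ideal_powM.
  by apply/ideal_pow1/ideal_pow_prod.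
exact: (IHl (fun i j => g i (rshift k j))).
Qed.

(** The working form of being a monomial ideal: no generators are named, and the property is shown
    below to pass to powers and integral closures. *)
Definition supp_closed I := forall f, f \in I <-> forall m, m \in msupp f -> 'X_[m] \in I.

Lemma supp_closedI I :
  (forall f m, f \in I -> m \in msupp f -> 'X_[m] \in I) -> supp_closed I.
Proof.
move=> suppI f; split=> [fI m mf|Xf]; first exact: suppI mf.
rewrite [f]mpolyE big_seq; apply: rpred_sum => m mf.
by apply: ideal_scale; apply: Xf.
Qed.

Lemma mpolyX_ideal_le I m m' : (m <= m')%MM -> 'X_[m] \in I -> 'X_[m'] \in I.
Proof. by move=> /submK <- mI; rewrite mpolyXD; apply: ideal_mull. Qed.

Lemma msupp_mulX f m m' : m \in msupp (f * 'X_[m']) ->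
  exists2 z, z \in msupp f & m = (m' + z)%MM.
Proof. by rewrite (perm_mem (msuppMX _ _)) => /mapP[z zf ->]; exists z. Qed.

Lemma monomial_supp_closed I : monomial_ideal I -> supp_closed I.
Proof.
move=> [A AP]; apply: supp_closedI => f m /AP[r [a [mu [muA ->]]]].
move=> /msupp_sum_le /flattenP[_ /mapP[i _ ->]] /msupp_mulX[z _ ->].
apply: (mpolyX_ideal_le (m := mu i)); first exact: lem_addr.
apply/AP; exists 1%N, (fun=> 1), (fun=> mu i); split=> //.
by rewrite big_ord1 mul1r.
Qed.

(** Otherwise any finite list of monomials of [I] can be extended by one that no member divides;
    iterating contradicts [dickson]. *)
Lemma monomial_generators I : exists s : seq 'X_{1..n},
  [/\ uniq s, forall e, e \in s -> 'X_[e] \in I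
    & forall m, 'X_[m] \in I -> exists2 e, e \in s & (e <= m)%MM].
Proof.
apply: contrapT => nogen.
(* The condition on [s] sits under the existential, so choice yields a function [h] defined on all
   lists. *)
have next (s : seq 'X_{1..n}) : exists m, (forall e, e \in s -> 'X_[e] \in I) ->
    'X_[m] \in I /\ forall e, e \in s -> ~~ (e <= m)%MM.
  apply: contrapT => nonext; apply: nogen; exists (undup s).
  split=> [|e|m mI]; first exact: undup_uniq.
    by rewrite mem_undup => es; apply: contrapT => eI; apply: nonext; exists e => /(_ _ es).
  apply: contrapT => nog; apply: nonext; exists m => _; split=> // e es.
  by apply/negP => em; apply: nog; exists e; rewrite ?mem_undup.
have [h hP] := choice next.
pose L := fix F i := if i is j.+1 then h (F j) :: F j else [::].
have LI i e : e \in L i -> 'X_[e] \in I.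
  elim: i e => // i IHi e; rewrite inE => /predU1P[->|]; last exact: IHi.
  exact: (hP _ IHi).1.
have hL i j : (i < j)%N -> h (L i) \in L j.
  elim: j => // j IHj; rewrite ltnS leq_eqVlt inE => /predU1P[->|/IHj ->].
    by rewrite eqxx.
  by rewrite orbT.
(* Among the chosen monomials an earlier one now divides a later one, although it belongs to the
   list which the later one was chosen to avoid. *)
have [phi [phi_lt phiP]] := dickson (enum 'I_n) (fun x i => h (L i) x).
have /negP := (hP _ (LI (phi 1%N))).2 _ (hL _ _ (phi_lt 0%N 1%N isT)); apply.
by apply/mnm_lepP => x; apply: (phiP x (mem_enum _ x) 0%N 1%N).
Qed.

(** * Exponents of the monomials in a power of a monomial ideal *)

Section Generators.
Variables (s : seq 'X_{1..n}).
(** A product of [k] members of [s] divides ['X_[m]]. Multiplicities [w] replace a list of factors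
    so that [dickson] applies to them. *)
Definition pow_exponent (k : nat) m := exists w : 'X_{1..n} -> nat,
  \sum_(e <- s) w e = k /\ forall x, (\sum_(e <- s) w e * e x <= m x)%N.

Lemma pow_exponentD k l m m' :
  pow_exponent k m -> pow_exponent l m' -> pow_exponent (k + l) (m + m')%MM.
Proof.
move=> [w [<- wm]] [w' [<- wm']]; exists (fun e => w e + w' e)%N.
split=> [|x]; first by rewrite big_split.
rewrite mnmDE; under eq_bigr => e _ do rewrite mulnDl.
by rewrite big_split leq_add.
Qed.

Lemma pow_exponent0 m : pow_exponent 0 m.
Proof. by exists (fun=> 0%N); split=> [|x]; rewrite big1_eq. Qed.

(* The slack vectors [m *+ (N + l) - \sum w_l e *+ e] and the weights [w_l] both
   increase from some [l] to some [l' > l]; subtracting the two inequalities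
   gives [m *+ (l' - l)]. *)
Lemma almost_integral_exponent N m :
  (forall l, pow_exponent l (m *+ (N + l))%MM) ->
  exists2 M, (0 < M)%N & pow_exponent M (m *+ M)%MM.
Proof.
move=> /choice[w wP].
pose u (x : 'X_{1..n} + 'I_n) l := match x with
  | inl e => w l e
  | inr x => (m x * (N + l) - \sum_(e <- s) w l e * e x)%N end.
have [phi [phi_lt phiP]] :=
  dickson (map inl s ++ map inr (enum 'I_n)) u.
have w_le e : e \in s -> (w (phi 0%N) e <= w (phi 1%N) e)%N.
  by move=> es; apply: (phiP (inl e) _ 0%N 1%N); rewrite // mem_cat map_f.
have u_le x : (u (inr x) (phi 0%N) <= u (inr x) (phi 1%N))%N.
  by apply: phiP; rewrite // mem_cat map_f ?orbT ?mem_enum.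
have lt01 := phi_lt 0%N 1%N isT.
exists (phi 1%N - phi 0%N)%N; first by rewrite subn_gt0.
exists (fun e => w (phi 1%N) e - w (phi 0%N) e)%N.
rewrite big_seq_cond sumnB => [|e /andP[es _]]; last exact: w_le.
rewrite -!big_seq_cond (wP (phi 1%N)).1 (wP (phi 0%N)).1; split=> // x.
under eq_bigr => e _ do rewrite mulnBl.
rewrite big_seq_cond sumnB => [|e /andP[es _]]; last by rewrite leq_mul2r w_le ?orbT.
rewrite -!big_seq_cond mulmnE.
(* The slack in [u] is a truncated subtraction; the bounds from [wP] make it exact. *)
have := (wP (phi 1%N)).2 x; have := (wP (phi 0%N)).2 x; have := u_le x.
rewrite /u !mulmnE !mulnDr mulnBr.
have : (m x * phi 0 <= m x * phi 1)%N by rewrite leq_mul2l (ltnW lt01) orbT.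
set s0 := (\sum_(e <- s) w (phi 0%N) _ * _)%N.
set s1 := (\sum_(e <- s) w (phi 1%N) _ * _)%N.
set a := (m x * phi 0)%N; set b := (m x * phi 1)%N; set c := (m x * N)%N.
lia.
Qed.

Variable I : ideal S.
Hypotheses (suppI : supp_closed I) (uniq_s : uniq s).
Hypothesis sI : forall e, e \in s -> 'X_[e] \in I.
Hypothesis genI : forall m, 'X_[m] \in I -> exists2 e, e \in s & (e <= m)%MM.

Lemma pow_exponent1 m : 'X_[m] \in I -> pow_exponent 1 m.
Proof.
move=> /genI[e es em]; exists (fun e' => (e' == e) : nat); split=> [|x].
  by rewrite (bigD1_seq e) //= eqxx big1 // => e' /negPf->.
rewrite (bigD1_seq e) //= eqxx mul1n big1 => [|e' /negPf-> //].
by rewrite addn0; apply/mnm_lepP.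
Qed.

(** Orders add under products: a coefficient counts 0, and a factor in [I] counts 1 because its
    monomials lie in [I]. *)
Lemma msupp_ideal_pow k f m : f \in ideal_pow I k -> m \in msupp f -> pow_exponent k m.
Proof.
have msuppM (p q : S) k' l : (forall z, z \in msupp p -> pow_exponent k' z) ->
    (forall z, z \in msupp q -> pow_exponent l z) ->
    forall z, z \in msupp (p * q) -> pow_exponent (k' + l) z.
  move=> hp hq _ /msuppM_le/allpairsP[[z z'] /= [zp zq ->]].
  by apply: pow_exponentD; [apply: hp | apply: hq].
move=> /asboolP[r [a [g [gI ->]]]].
move=> /msupp_sum_le /flattenP[_ /mapP[i _ ->]].
suff prodP z : z \in msupp (\prod_j g i j) -> pow_exponent k z.
  by move/(msuppM _ _ 0%N k (fun z _ => pow_exponent0 z) prodP).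
move: z; elim: k {a} g gI => [|k IHk] g gI z; first by move=> _; apply: pow_exponent0.
rewrite big_ord_recl; apply: (msuppM _ _ 1%N k) => [{}z zg|].
  by apply: pow_exponent1; apply: (suppI _).1 zg.
exact: (IHk (fun i j => g i (lift ord0 j))).
Qed.

Lemma pow_exponentP k m : 'X_[m] \in ideal_pow I k <-> pow_exponent k m.
Proof.
split=> [/msupp_ideal_pow|[w [<- wm]]]; first by apply; rewrite msuppX inE.
apply: (@mpolyX_ideal_le _ (\big[mnm_add/0%MM]_(e <- s) (e *+ w e)%MM)).
  apply/mnm_lepP => x; rewrite mnm_sumE (leq_trans _ (wm x)) //.
  by apply: leq_sum => e _; rewrite mulmnE mulnC.
elim: s sI {wm} => [|e t IHt] tI; first by rewrite !big_nil ideal_pow0.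
rewrite !big_cons mpolyXD; apply: ideal_powM.
  by have := ideal_powX (w e) (ideal_pow1 (tI e (mem_head _ _))); rewrite mpolyXn mul1n.
by apply: IHt => e' e't; apply: tI; rewrite inE e't orbT.
Qed.

End Generators.

(** * Integral closures of monomial ideals *)

(** With [N] the degree of the integral equation, multiplying it by [f ^+ (p - N)] expresses
    [f ^+ p] through lower powers; strong induction on [p] follows. *)
Lemma integral_pow_mem I f : integral_over_ideal I f ->
  exists N, forall l, f ^+ (N + l) \in ideal_pow I l.
Proof.
move=> [N [c [N_gt0 cI fE]]]; exists N.
suff fp p : f ^+ p \in ideal_pow I (p - N) by move=> l; have := fp (N + l)%N; rewrite addKn.
have [b] := ubnP p; elim: b p => // b IHb p; rewrite ltnS => pb.
have [pN|Np] := leqP p N.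
  by move: pN; rewrite -subn_eq0 => /eqP->; apply: ideal_pow0.
have -> : f ^+ p = - \sum_(1 <= i < N.+1) c i * f ^+ (p - i).
  rewrite -(subnKC (ltnW Np)) exprD (canRL (addrK _) fE) sub0r mulNr mulr_suml.
  congr (- _); apply: eq_big_nat => i /andP[_ iN].
  by rewrite -mulrA -exprD addnBAC.
apply: idealN; rewrite big_nat; apply: rpred_sum => i /andP[i_gt0 iN].
(* When [p - i < N] the truncated difference is 0, so this exponent may exceed [p - N]. *)
apply: (@ideal_pow_le _ _ (i + (p - i - N))); first lia.
by apply: ideal_powM; [apply: cI; rewrite i_gt0 | apply: IHb; lia].
Qed.

Lemma pow_mem_integral I M f : (0 < M)%N -> f ^+ M \in ideal_pow I M ->
  f \in integral_closure I.
Proof.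
move=> M_gt0 fM; apply/asboolP.
(* The integral equation is [T ^+ M - f ^+ M = 0], evaluated at [f]. *)
exists M, (fun i => if i == M then - f ^+ M else 0); split=> // [i _|].
  by case: eqP => [->|_]; [apply: idealN | apply: rpred0].
rewrite big_nat_recr //= eqxx subnn mulr1 big_nat big1 ?add0r ?subrr // => i.
by move=> /andP[_ iM]; rewrite ltn_eqF ?mul0r.
Qed.

Lemma mlead_integral I f : supp_closed I -> f \in integral_closure I -> f != 0 ->
  exists2 M, (0 < M)%N & 'X_[mlead f *+ M] \in ideal_pow I M.
Proof.
move=> suppI /asboolP/integral_pow_mem[N fN] f0.
have [s [uniq_s sI genI]] := monomial_generators I.
have powP := pow_exponentP suppI uniq_s sI genI.
have [|M M_gt0 /powP] := @almost_integral_exponent s N (mlead f).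
  (* Over a field, the leading exponent of [f ^+ (N + l)] is that of [f] times [N + l]. *)
  move=> l; apply: (msupp_ideal_pow suppI uniq_s genI (fN l)).
  by rewrite -mleadX // mlead_supp // expf_neq0.
by exists M.
Qed.

Lemma mpolyX_integralP I m : supp_closed I -> 'X_[m] \in integral_closure I <->
  exists2 M, (0 < M)%N & 'X_[m *+ M] \in ideal_pow I M.
Proof.
move=> suppI; split=> [mI|[M M_gt0 mM]].
  by rewrite -{1}[m](mleadXm K); apply: mlead_integral => //; rewrite -msupp_eq0 msuppX.
by apply: (pow_mem_integral M_gt0); rewrite mpolyXn.
Qed.

Lemma supp_closed_integral I : supp_closed I -> supp_closed (integral_closure I).
Proof.
move=> suppI; apply: supp_closedI => f m.
elim/mleadrect: f => f IHf fI mf.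
have f0 : f != 0 by apply: contraTneq mf => ->; rewrite msupp0.
have lI : 'X_[mlead f] \in integral_closure I.
  by apply/mpolyX_integralP => //; apply: mlead_integral.
have [-> //|ml] := eqVneq m (mlead f).
(* The coefficient at [m] is unchanged, so [m] stays in the support of [g] while the leading
   monomial drops. *)
pose g := f - f@_(mlead f) *: 'X_[mlead f].
have mg : m \in msupp g.
  rewrite mcoeff_msupp mcoeffB mcoeffZ mcoeffX [_ == m]eq_sym (negPf ml).
  by rewrite mulr0 subr0 -mcoeff_msupp.
have g0 : g != 0 by apply: contraTneq mg => ->; rewrite msupp0.
apply: (IHf g _ _ mg); first exact: ltm_mleadD.
exact: idealB (ideal_scale _ lI).
Qed.

Lemma supp_closed_pow I k : supp_closed I -> supp_closed (ideal_pow I k).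
Proof.
move=> suppI; apply: supp_closedI => f m fI mf.
have [s [uniq_s sI genI]] := monomial_generators I.
apply/(pow_exponentP suppI uniq_s sI genI).
exact: (msupp_ideal_pow suppI uniq_s genI fI).
Qed.

(** Since [(I^k)^M = I^(k M)], a witness [M] for the left side gives [k * M] for the right; a
    witness [M] for the right serves the left after raising to the power [k]. *)
Lemma mpolyX_integral_pow I k m : supp_closed I -> (0 < k)%N ->
  'X_[m *+ k] \in integral_closure (ideal_pow I k) <-> 'X_[m] \in integral_closure I.
Proof.
move=> suppI k_gt0; split=> /mpolyX_integralP.
  case=> [|M M_gt0]; first exact: supp_closed_pow.
  rewrite ideal_pow_pow -mpolyXn -mpolyXn -exprM; apply: pow_mem_integral.
  by rewrite muln_gt0 k_gt0.
case=> // M M_gt0 mM; apply: (pow_mem_integral M_gt0).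
rewrite ideal_pow_pow -!mpolyXn -exprM mulnC exprM.
by apply: ideal_powX; rewrite mpolyXn.
Qed.

End MonomialIdeals.

(** * Classes in a quotient and their representatives *)

Section SubQuotientTheory.
Variables (R : pzRingType) (V : lmodType R) (A B : submodClosed V).
Implicit Types x : submod_type A.
Local Notation pi := (@subquot_pi R V A B).

Lemma submod_typeP (a : V) : a \in A -> exists x : submod_type A, val x = a.
Proof. by move=> aA; exists (exist (fun a => a \in A) a aA). Qed.

Lemma val_submod0 : val (0 : submod_type A) = 0.
Proof. exact: raddf0. Qed.

Lemma subquot_pi_surj (w : subquot A B) : exists x, w = pi x.
Proof. by rewrite -[w]subquot_pi_repr; eexists. Qed.

Lemma scale_subquot_pi a x : a *: pi x = pi (a *: x).
Proof. exact: subquot_piZ. Qed.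

Lemma subquot_pi0 : pi 0 = 0.
Proof. by apply: (addIr (pi 0)); rewrite -subquot_piD !add0r. Qed.

Lemma subquot_pi_sum (I : Type) (r : seq I) (F : I -> submod_type A) :
  \sum_(i <- r) pi (F i) = pi (\sum_(i <- r) F i).
Proof. by rewrite (big_morph pi (@subquot_piD _ _ _ _) subquot_pi0). Qed.

Lemma subquot_pi_eq0 x : pi x = 0 <-> val x \in B.
Proof.
rewrite -subquot_pi0; have := subquot_piP B x 0.
by rewrite val_submod0 subr0 => /rwP.
Qed.

End SubQuotientTheory.

(** * Cones of exponents *)

Section Cones.
Variables (K : fieldType) (n : nat).
Local Notation S := {mpoly K[n]}.
Implicit Types (A B : ideal S) (f v : S) (m b z : 'X_{1..n}) (Z : {set 'I_n}).

(** The exponents of the monomials in ['X_[b]] K[Z]. *)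
Definition cone b Z m := (b <= m)%MM && [forall j, (j \notin Z) ==> (m j == b j)].

Lemma cone_refl b Z : cone b Z b.
Proof. by rewrite /cone lepm_refl; apply/forallP => j; rewrite eqxx implybT. Qed.

Lemma coneD b Z v z : in_vars Z v -> z \in msupp v -> cone b Z (b + z)%MM.
Proof.
move=> vZ zv; rewrite /cone lem_addr; apply/forallP => j; apply/implyP => jZ.
by rewrite mnmDE (vZ z) // addn0.
Qed.

Lemma in_varsX b Z m : cone b Z m -> in_vars Z ('X_[m - b] : S).
Proof.
move=> /andP[_ /forallP mZ] z; rewrite msuppX inE => /eqP-> j jZ.
by have /implyP/(_ jZ)/eqP := mZ j; rewrite mnmBE => ->; rewrite subnn.
Qed.

Lemma in_vars1 Z : in_vars Z (1 : S).
Proof. by move=> m; rewrite msupp1 inE => /eqP-> j _; rewrite mnm0E. Qed.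

Lemma in_vars0 Z : in_vars Z (0 : S).
Proof. by move=> m; rewrite msupp0. Qed.

Lemma in_varsB Z v v' : in_vars Z v -> in_vars Z v' -> in_vars Z (v - v').
Proof.
move=> vZ vZ' m /msuppB_le; rewrite mem_cat => /orP[]; [exact: vZ | exact: vZ'].
Qed.

Lemma in_varsZ Z c v : in_vars Z v -> in_vars Z (c *: v).
Proof. by move=> vZ m /msuppZ_le; apply: vZ. Qed.

Lemma in_vars_sum (T : Type) Z (r : seq T) (P : pred T) (F : T -> S) :
  (forall i, P i -> in_vars Z (F i)) -> in_vars Z (\sum_(i <- r | P i) F i).
Proof.
move=> FZ; apply: (big_ind (in_vars Z)) => //; first exact: in_vars0.
by move=> p q pZ qZ m /msuppD_le; rewrite mem_cat => /orP[]; [exact: pZ | exact: qZ].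
Qed.

Lemma mcoeff_sum_filter f (P : pred 'X_{1..n}) m :
  (\sum_(z <- msupp f | P z) f@_z *: 'X_[z])@_m = if P m then f@_m else 0.
Proof.
rewrite [LHS]raddf_sum /= big_mkcond /=.
have E z : (if P z then (f@_z *: 'X_[z])@_m else 0) =
    if z == m then (if P m then f@_m else 0) else 0.
  rewrite mcoeffZ mcoeffX; case: eqP => [->|_]; first by rewrite mulr1.
  by rewrite mulr0 if_same.
under eq_bigr => z _ do rewrite E.
have [mf|mf] := boolP (m \in msupp f).
  rewrite (bigD1_seq m) ?msupp_uniq //= eqxx big1 ?addr0 // => z /negPf->//.
rewrite big1_seq => [|z /= zf]; first by rewrite memN_msupp_eq0 // if_same.
by case: eqP => // zm; rewrite -zm zf in mf.
Qed.

Lemma mcoeff_mul_monomial v (c : K) b z : (v * (c *: 'X_[b]))@_(b + z) = c * v@_z.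
Proof. by rewrite -scalerAr mcoeffZ mcoeffMX. Qed.

Lemma msupp_mul_monomial v (c : K) b m : m \in msupp (v * (c *: 'X_[b])) ->
  c != 0 /\ exists2 z, z \in msupp v & m = (b + z)%MM.
Proof.
have [->|c0] := eqVneq c 0; first by rewrite scale0r mulr0 msupp0.
by rewrite -scalerAr => /msuppZ_le/msupp_mulX.
Qed.

Lemma monomial_mul_cone (c : K) b Z m : c != 0 -> cone b Z m ->
  (c^-1 *: 'X_[m - b]) * (c *: 'X_[b]) = 'X_[m] :> S.
Proof.
move=> c0 /andP[bm _]; rewrite -scalerAl -scalerAr scalerA mulVf // scale1r.
by rewrite -mpolyXD submK.
Qed.

(* A zero coefficient [c i] encodes an empty cone. *)
Definition cone_partition A B (r : nat) (c : 'I_r -> K) (b : 'I_r -> 'X_{1..n})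
    (Z : 'I_r -> {set 'I_n}) : Prop :=
  [/\ forall i m, c i != 0 -> cone (b i) (Z i) m -> 'X_[m] \in A /\ 'X_[m] \notin B,
      forall m, 'X_[m] \in A -> 'X_[m] \notin B ->
        exists2 i, c i != 0 & cone (b i) (Z i) m
    & forall m i j, c i != 0 -> c j != 0 ->
        cone (b i) (Z i) m -> cone (b j) (Z j) m -> i = j].

(** * Stanley decompositions as cone partitions *)

Section Decomposition.
Variables (A B : ideal S) (suppA : supp_closed A) (suppB : supp_closed B).
Local Notation deg := (@subquot_degree K n A B).
Local Notation pi := (@subquot_pi S S^o A B).

(** A multidegree fixes the exponent, so a homogeneous representative has at most one term. The zero
    class gets coefficient 0, so a nonzero coefficient certifies a nonzero class. *)
Lemma homogeneous_monomial (u : subquot A B) : homogeneous deg u ->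
  exists t : submod_type A * (K * 'X_{1..n}),
    [/\ u = pi t.1, val t.1 = t.2.1 *: 'X_[t.2.2]
      & t.2.1 != 0 -> 'X_[t.2.2] \notin B].
Proof.
move=> [d [x [dx ->]]]; have [xB|xB] := boolP (val x \in B).
  exists (0, (0, 0%MM)); split=> [||/eqP//].
    by rewrite subquot_pi0; apply/subquot_pi_eq0.
  by rewrite val_submod0 scale0r.
have x0 : val x != 0 by apply: contraNneq xB => ->; rewrite rpred0.
have xE : val x = (val x)@_(mlead (val x)) *: 'X_[mlead (val x)].
  apply/mpolyP => m; rewrite mcoeffZ mcoeffX; have [->|lm] := eqVneq (mlead _) m.
    by rewrite mulr1.
  rewrite mulr0; apply/eqP; rewrite mcoeff_eq0; apply: contraNN lm => mx.
  apply/eqP/mnmP => j; apply/eqP.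
  by rewrite -eqz_nat (dx _ mx) (dx _ (mlead_supp x0)).
exists (x, ((val x)@_(mlead (val x)), mlead (val x))); split=> //= _.
by apply: contraNN xB => lB; rewrite xE; apply: ideal_scale.
Qed.

(** As [u] is nonzero, the basis has an element; it is a multiple of [u], so [v] kills it and
    freeness gives [v = 0]. *)
Lemma stanley_space_torsionfree (u : subquot A B) Z v :
  stanley_space deg u Z -> u != 0 -> in_vars Z v -> v *: u = 0 -> v = 0.
Proof.
move=> [_ [W [Wspan span free]]] u0 vZ vu.
have [|[|r] [p [b [_ Wb uE]]]] := span u.
- by exists 1; split; [exact: in_vars1 | rewrite scale1r].
- by rewrite uE big_ord0 eqxx in u0.
have [v' [_ bE]] := Wspan _ (Wb ord0).
apply: (free 1%N (fun=> v) (fun=> b ord0) _ _ _ _ ord0) => // [i j _|].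
  by rewrite !ord1.
by rewrite big_ord1 bE scalerA mulrC -[_ *: _]scalerA vu scaler0.
Qed.

Variables (r : nat) (x : 'I_r -> submod_type A) (c : 'I_r -> K) (b : 'I_r -> 'X_{1..n}).
Variable Z : 'I_r -> {set 'I_n}.
Hypothesis xE : forall i, val (x i) = c i *: 'X_[b i].

Lemma val_scale (v : S) i : val (v *: x i) = v * (c i *: 'X_[b i]).
Proof. by rewrite linearZ /= xE. Qed.

Lemma val_sum_scale (v : 'I_r -> S) :
  val (\sum_i v i *: x i) = \sum_i v i * (c i *: 'X_[b i]).
Proof. by rewrite raddf_sum; apply: eq_bigr => i _; apply: val_scale. Qed.

Lemma decomposition_cone_partition :
  (forall i, c i != 0 -> 'X_[b i] \notin B) ->
  stanley_decomposition deg (fun i => pi (x i)) Z -> cone_partition A B c b Z.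
Proof.
move=> bB [stan dec].
have u0 i : c i != 0 -> pi (x i) != 0.
  move=> ci0; apply: contraNneq (bB i ci0) => /subquot_pi_eq0; rewrite xE.
  by move/(ideal_scale (c i)^-1); rewrite scalerA mulVf // scale1r.
have bA i : c i != 0 -> 'X_[b i] \in A.
  move=> ci0; have := valP (x i); rewrite xE.
  by move/(ideal_scale (c i)^-1); rewrite scalerA mulVf // scale1r.
(* Were ['X_[m]] in [B], a nonzero monomial of K[Z] would kill the class of [x i]. *)
have coneAB i m : c i != 0 -> cone (b i) (Z i) m -> 'X_[m] \in A /\ 'X_[m] \notin B.
  move=> ci0 mi; split; first by apply: mpolyX_ideal_le (bA i ci0); case/andP: mi.
  apply/negP => mB; have vu : ((c i)^-1 *: 'X_[m - b i]) *: pi (x i) = 0.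
    rewrite scale_subquot_pi; apply/subquot_pi_eq0.
    by rewrite val_scale (monomial_mul_cone ci0 mi).
  have /eqP := stanley_space_torsionfree (stan i) (u0 i ci0)
    (in_varsZ (c := (c i)^-1) (in_varsX mi)) vu.
  by rewrite scaler_eq0 invr_eq0 (negPf ci0) -msupp_eq0 msuppX.
split=> // [m mA mB|m i j ci0 cj0 mi mj].
  (* Expand the class of ['X_[m]]: without a cone through [m] no summand has a term at [m], so
     ['X_[m]] itself would lie in [B]. *)
  apply: contrapT => nocone.
  have [y yE] := submod_typeP mA.
  have [s [[/choice[v vP] sumE] _]] := dec (pi y).
  move: mB; apply/negP/negPn.
  apply: ((suppB ('X_[m] - \sum_i v i * (c i *: 'X_[b i]))).1 _ m).
    have := sumE; under eq_bigr => i _ do rewrite (vP i).2 scale_subquot_pi.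
    rewrite subquot_pi_sum => /subquot_piP; by rewrite yE val_sum_scale.
  rewrite mcoeff_msupp mcoeffB mcoeffX eqxx raddf_sum /= big1 ?subr0 ?oner_eq0 // => i _.
  apply/eqP; rewrite mcoeff_eq0; apply/negP => /msupp_mul_monomial[ci0 [z zv mE]].
  by apply: nocone; exists i; rewrite // mE; apply: coneD zv; apply: (vP i).1.
have [mA mB] := coneAB _ _ ci0 mi; have [y yE] := submod_typeP mA; pose w := pi y.
have w0 : w != 0 by apply: contraNneq mB => /subquot_pi_eq0; rewrite yE.
have spanw l : c l != 0 -> cone (b l) (Z l) m -> cyclic_span (pi (x l)) (Z l) w.
  move=> cl0 ml; exists ((c l)^-1 *: 'X_[m - b l]).
  split; first by apply: in_varsZ; apply: in_varsX.
  rewrite scale_subquot_pi; apply/subquot_piP; rewrite val_scale yE.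
  by rewrite (monomial_mul_cone cl0 ml) subrr rpred0.
have [s [_ uniqs]] := dec w.
(* By uniqueness the decomposition of [w] is concentrated in slot [l], for [l = i] and for [l = j]
   alike. *)
have sE l : c l != 0 -> cone (b l) (Z l) m -> s = [ffun l' => if l' == l then w else 0].
  move=> cl0 ml; apply: uniqs; split=> [l'|].
    rewrite ffunE; case: eqP => [->|_]; first exact: spanw.
    by exists 0; rewrite scale0r; split=> //; apply: in_vars0.
  rewrite (bigD1 l) //= ffunE eqxx big1 ?addr0 // => l' /negPf ll'.
  by rewrite ffunE ll'.
have := sE _ ci0 mi; rewrite (sE _ cj0 mj) => /ffunP/(_ i).
rewrite !ffunE eqxx; case: eqP => // _ /esym/eqP.
by rewrite (negPf w0).
Qed.

(** Existence: distribute the terms of a representative among the cones. Uniqueness: disjoint cones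
    allow no cancellation between summands. *)
Lemma cone_partition_decomposition :
  cone_partition A B c b Z -> stanley_decomposition deg (fun i => pi (x i)) Z.
Proof.
move=> [coneAB cover disj].
have torsionfree i v : c i != 0 -> in_vars (Z i) v -> v *: pi (x i) = 0 -> v = 0.
  move=> ci0 vZ; rewrite scale_subquot_pi => /subquot_pi_eq0; rewrite val_scale => vB.
  apply/eqP/negP => /negP v0; have zv := mlead_supp v0.
  have [_ /negP] := coneAB _ _ ci0 (coneD (b i) vZ zv); apply.
  apply: ((suppB _).1 vB); rewrite mcoeff_msupp mcoeff_mul_monomial mulf_neq0 //.
  by rewrite -mcoeff_msupp.
split=> [i|w].
  split.
    exists (fun j => (b i j)%:Z), (x i); split=> // m; rewrite xE => /msuppZ_le.
    by rewrite msuppX inE => /eqP->.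
  have [ci0|ci0] := eqVneq (c i) 0.
    have x0 : pi (x i) = 0 by apply/subquot_pi_eq0; rewrite xE ci0 scale0r rpred0.
    (* A zero coefficient gives the zero space, free on the empty basis. *)
    exists (fun=> False); split=> [_ []|w [v [_ ->]]|q p b' _ b'F _ _ j]; last by case: (b'F j).
    exists 0%N, (fun=> 0), (fun=> 0); split=> [[]//|[]//|].
    by rewrite big_ord0 x0 scaler0.
  exists (eq (pi (x i))); split=> [_ <-|w [v [vZ ->]]|q p b' pZ b'E b'_inj sum0 k].
  - by exists 1; split; [exact: in_vars1 | rewrite scale1r].
  - by exists 1%N, (fun=> v), (fun=> pi (x i)); split=> //; rewrite big_ord1.
  - have kE k' : k' = k by apply: b'_inj; rewrite -!b'E.
    apply: (torsionfree _ _ ci0 (pZ k)); rewrite -sum0 (bigD1 k) //= -b'E big1 ?addr0 //.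
    by move=> k' /eqP[]; apply: kE.
have [y ->] := subquot_pi_surj w.
pose f := val y; pose P i m := (c i != 0) && cone (b i) (Z i) m.
(* The part of [f] supported on cone [i], divided by [c i *: 'X_[b i]]. *)
pose v i := \sum_(m <- msupp f | P i m) f@_m *: ((c i)^-1 *: 'X_[m - b i]) : S.
have vE i : v i * (c i *: 'X_[b i]) = \sum_(m <- msupp f | P i m) f@_m *: 'X_[m].
  rewrite mulr_suml; apply: eq_bigr => m /andP[ci0 mi].
  by rewrite -scalerAl (monomial_mul_cone ci0 mi).
have vZ i : in_vars (Z i) (v i).
  by apply: in_vars_sum => m /andP[_ mi]; apply/in_varsZ/in_varsZ/in_varsX.
have sumv : pi y = \sum_i v i *: pi (x i).
  under eq_bigr => i _ do rewrite scale_subquot_pi.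
  rewrite subquot_pi_sum; apply/subquot_piP; rewrite val_sum_scale.
  under eq_bigr => i _ do rewrite vE.
  apply/suppB => m; rewrite mcoeff_msupp mcoeffB raddf_sum /=.
  under eq_bigr => i _ do rewrite mcoeff_sum_filter.
  apply: contraNT => mB; apply/eqP.
  have [mf|mf] := boolP (m \in msupp f); last first.
    rewrite memN_msupp_eq0 // sub0r big1 ?oppr0 // => i _.
    by rewrite if_same.
  have mA : 'X_[m] \in A by apply: (suppA _).1 mf; apply: valP.
  have [i ci0 mi] := cover m mA mB.
  rewrite (bigD1 i) //= {1}/P ci0 mi big1 ?addr0 ?subrr // => j ij.
  by rewrite /P; case: ifP => // /andP[cj0 mj]; rewrite (disj m j i) ?eqxx in ij.
exists [ffun i => v i *: pi (x i)]; split=> [|s [spans sumE]].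
  split=> [i|]; first by exists (v i); rewrite ffunE.
  by rewrite sumv; apply: eq_bigr => i _; rewrite ffunE.
have [v' v'P] := choice spans.
pose p i := v i - v' i.
have pZ i : in_vars (Z i) (p i) by apply: in_varsB => //; apply: (v'P i).1.
have pB : \sum_i p i * (c i *: 'X_[b i]) \in B.
  rewrite -val_sum_scale; apply/subquot_pi_eq0; rewrite -subquot_pi_sum.
  under eq_bigr => i _ do rewrite -scale_subquot_pi scalerBl -(v'P i).2.
  by rewrite sumrB -sumE sumv subrr.
apply/ffunP => i; rewrite ffunE (v'P i).2; apply/eqP; rewrite -subr_eq0 -scalerBl.
rewrite -/(p i); have [->|p0] := eqVneq (p i) 0; first by rewrite scale0r.
have [ci0|ci0] := eqVneq (c i) 0.
  apply/eqP; rewrite scale_subquot_pi; apply/subquot_pi_eq0.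
  by rewrite val_scale ci0 scale0r mulr0 rpred0.
(* The exponent [b i + mlead (p i)] lies in cone [i] only, so its term survives in the sum [pB],
   which puts a monomial of the cone into [B]. *)
have zp := mlead_supp p0; have mi := coneD (b i) (pZ i) zp.
have [_ /negP[]] := coneAB _ _ ci0 mi; apply: ((suppB _).1 pB).
rewrite mcoeff_msupp raddf_sum (bigD1 i) //= mcoeff_mul_monomial big1 => [|j ji].
  by rewrite addr0 mulf_neq0 // -mcoeff_msupp.
apply/eqP; rewrite mcoeff_eq0; apply/negP => /msupp_mul_monomial[cj0 [z zpj mE]].
by case/eqP: ji; apply: (disj _ j i cj0 ci0 _ mi); rewrite mE; apply: coneD zpj.
Qed.

End Decomposition.

(** * Pulling decompositions back along multiplication of exponents by [k] *)

Lemma attained_transfer A B A' B' (k : nat) d :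
  supp_closed A -> supp_closed B -> supp_closed A' -> supp_closed B' -> (0 < k)%N ->
  (forall m, 'X_[m *+ k] \in A <-> 'X_[m] \in A') ->
  (forall m, 'X_[m *+ k] \in B <-> 'X_[m] \in B') ->
  attained (@subquot_degree K n A B) d -> attained (@subquot_degree K n A' B') d.
Proof.
move=> sA sB sA' sB' k_gt0 AA' BB' [r [u [Z [dec <-]]]].
have [t tP] := choice (fun i => homogeneous_monomial (dec.1 i).1).
pose x i := (t i).1; pose c i := (t i).2.1; pose a i := (t i).2.2.
have uE : u = fun i => subquot_pi B (x i) by apply/funext => i; case: (tP i).
have xE i : val (x i) = c i *: 'X_[a i] by case: (tP i).
have aB i : c i != 0 -> 'X_[a i] \notin B by case: (tP i).
rewrite uE in dec; have [coneAB cover disj] := decomposition_cone_partition sB xE aB dec.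
(* Outside [Z i] the exponent is fixed at [a i j], so the preimage is empty unless [k] divides it;
   [c' i = 0] then records the empty cone. *)
pose good i := (c i != 0) && [forall j, (j \notin Z i) ==> (k %| a i j)%N].
pose c' i : K := (good i)%:R.
(* Adding [k.-1] before dividing rounds up; the quotient is exact wherever [k] divides [a i j]. *)
pose b i := [multinom ((a i j + k.-1) %/ k)%N | j < n].
have c'E i : (c' i != 0) = good i by rewrite /c'; case: (good i); rewrite ?oner_eq0 ?eqxx.
have coneE i m : (c' i != 0) && cone (b i) (Z i) m =
    (c i != 0) && cone (a i) (Z i) (m *+ k)%MM.
  have leE j : (b i j <= m j)%N = (a i j <= (m *+ k)%MM j)%N.
    by rewrite mnmE mulmnE -ltnS ltn_divLR // mulSn; apply/idP/idP; lia.
  have eqE j : (k %| a i j)%N && (m j == b i j) = ((m *+ k)%MM j == a i j).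
    rewrite mnmE mulmnE; apply/andP/eqP => [[/dvdnP[q ->] /eqP->]|<-].
      by rewrite divnMDl // divn_small ?addn0 // ltn_predL.
    by rewrite dvdn_mull // divnMDl // divn_small ?addn0 ?eqxx // ltn_predL.
  rewrite c'E /good -andbA; case: (c i != 0) => //=.
  apply/and3P/andP => [[/forallP dvd /mnm_lepP bm /forallP eqb]|[/mnm_lepP am /forallP eqa]].
    split; first by apply/mnm_lepP => j; rewrite -leE.
    apply/forallP => j; apply/implyP => jZ.
    by rewrite -eqE (implyP (dvd j) jZ) (implyP (eqb j) jZ).
  split; last 1 first.
  - apply/forallP => j; apply/implyP => jZ.
    by have := implyP (eqa j) jZ; rewrite -eqE => /andP[].
  - apply/forallP => j; apply/implyP => jZ.
    by have := implyP (eqa j) jZ; rewrite -eqE => /andP[].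
  - by apply/mnm_lepP => j; rewrite leE.
have /choice[x' x'E] i : exists y : submod_type A', val y = c' i *: 'X_[b i].
  apply: submod_typeP; have [->|ci0] := eqVneq (c' i) 0; first by rewrite scale0r rpred0.
  (* The apex lies in its own cone, so [coneE] sends its [k]-fold into a cone of the given
     partition, hence into [A]. *)
  apply/ideal_scale/AA'; have := cone_refl (b i) (Z i).
  by move=> bi; have := coneE i (b i); rewrite ci0 bi => /esym/andP[ci /(coneAB _ _ ci)[]].
exists r, (fun i => subquot_pi B' (x' i)), Z; split=> //.
apply: (cone_partition_decomposition sA' sB' x'E); split=>
  [i m ci0 mi|m mA mB|m i j ci0 cj0 mi mj].
- have := coneE i m; rewrite ci0 mi => /esym/andP[ci /(coneAB _ _ ci)[mA mB]].
  by split; [apply/AA' | apply: contraNN mB => /BB'].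
- have [|i ci mi] := cover (m *+ k)%MM ((AA' m).2 mA); first by apply: contraNN mB => /BB'.
  by exists i; have := coneE i m; rewrite ci mi => /andP[].
- have := coneE i m; rewrite ci0 mi => /esym/andP[ci mi'].
  have := coneE j m; rewrite cj0 mj => /esym/andP[cj mj'].
  exact: (disj _ _ _ ci cj mi' mj').
Qed.
End Cones.

(** * Comparison of Stanley depths *)

Lemma enat_le_sdepth (K : fieldType) (n : nat) (M M' : lmodType {mpoly K[n]})
    (D : ('I_n -> int) -> M -> Prop) (D' : ('I_n -> int) -> M' -> Prop) :
  (forall d, attained D d -> attained D' d) -> enat_le (sdepth D) (sdepth D').
Proof.
move=> DD'; rewrite /sdepth; case: asboolP => [/DD' DN|_].
  by case: asboolP.
case: asboolP => //= _; apply/bigmax_leqP => d /asboolP/DD' dD'.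
by apply: (leq_bigmax_cond (F := fun d : 'I_n.+1 => val d)); apply/asboolP.
Qed.

Theorem theorem2p1 (K : fieldType) (n : nat) (I J : ideal {mpoly K[n]})
    (monI : monomial_ideal I) (monJ : monomial_ideal J)
    (subJI : {subset J <= I}) (k : nat) (k_gt0 : (1 <= k)%N) :
  enat_le (sdepth_quot (integral_closure (ideal_pow I k))
                       (integral_closure (ideal_pow J k)))
          (sdepth_quot (integral_closure I) (integral_closure J)).
Proof.
have sI := monomial_supp_closed monI; have sJ := monomial_supp_closed monJ.
rewrite /sdepth_quot; apply: enat_le_sdepth => d.
have powE (L : ideal {mpoly K[n]}) (sL : supp_closed L) m := mpolyX_integral_pow m sL k_gt0.
have sint (L : ideal {mpoly K[n]}) := @supp_closed_integral K n L.
have spow (L : ideal {mpoly K[n]}) := @supp_closed_pow K n L k.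
exact: (attained_transfer (sint _ (spow _ sI)) (sint _ (spow _ sJ)) (sint _ sI) (sint _ sJ)
  k_gt0 (powE _ sI) (powE _ sJ)).
Qed.
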